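(* For any base $b\ge2$, $K(2)=b^2+1$ if $b$ is even and $K(2)=b+1$ if $b$ is odd. Equivalently, writing $K(2)=b^{B(2)}+(\text{lower-order terms})$ with $B(2)=\lfloor\log_b K(2)\rfloor$, $B(2)=2$ if $b$ is even and $B(2)=1$ if $b$ is odd.
   Context: Fix a base $b\ge2$. For $v\in\mathbb{N}$, $s(v)$ is the sum of the base-$b$ digits of $v$, $f(v)=v+s(v)$, and $F(u)=|\{v\in\mathbb{N}: f(v)=u\}|$. For $n\ge1$, $K(n)$ denotes the smallest $u\in\mathbb{N}$ with $F(u)=n$. *)

(* Defs.v *)
From mathcomp Require Import all_boot finmap.
From mathcomp Require Import boolp classical_sets functions cardinality.

Set Implicit Arguments.
Unset Strict Implicit.
Unset Printing Implicit Defensive.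

Definition digit (b v i : nat) : nat := v %/ b ^ i %% b.

(* For 1 < b we have v < b ^ v, so the digits of index >= v all vanish and
   the sum below ranges over all the nonzero digits; see [digit_expansion]. *)
Definition s (b v : nat) : nat := \sum_(i < v) digit b v i.

Lemma digit_expansion (b v : nat) (hb : 1 < b) :
  v = \sum_(i < v) digit b v i * b ^ i.
Proof.
have mod_expansion n : v %% b ^ n = \sum_(i < n) digit b v i * b ^ i.
  elim: n => [|n IHn]; first by rewrite modn1 big_ord0.
  rewrite big_ord_recr /= -IHn /digit.
  have [pn ps] : 0 < b ^ n /\ 0 < b ^ n.+1 by rewrite !expn_gt0 (ltnW hb).
  rewrite {1}(divn_eq v (b ^ n)) {1}(divn_eq (v %/ b ^ n) b).
  rewrite mulnDl -mulnA -expnS -addnA modnMDl modn_small 1?addnC //.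
  rewrite expnS (@leq_trans (((v %/ b ^ n) %% b).+1 * b ^ n)) //.
    by rewrite mulSn ltn_add2r ltn_pmod.
  by rewrite leq_mul2r ltn_pmod ?orbT // ltnW.
by rewrite -mod_expansion modn_small // ltn_expl.
Qed.

Definition f (b v : nat) : nat := v + s b v.

Lemma finite_fiber (b u : nat) : finite_set [set v : nat | f b v = u]%classic.
Proof.
apply: (@sub_finite_set _ _ `I_u.+1); last exact: finite_II.
by move=> v /= <-; rewrite ltnS leq_addr.
Qed.

(* [fset_set] is the genuine finite set here, by [finite_fiber]. *)
Definition F (b u : nat) : nat :=
  #|` fset_set [set v : nat | f b v = u]%classic |%fset.

(* A relation rather than a function, since the existence of a [u] with
   [F b u = n] is not known a priori. *)
Definition is_K (b n u : nat) : Prop :=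
  F b u = n /\ forall w : nat, F b w = n -> u <= w.

(* Main.v *)
(** For even [b] the fibre of [b ^ 2 + 1] is [{b ^ 2, (b - 1) b + 1}], and for
    odd [b] the fibre of [b + 1] is [{b, (b + 1) / 2}]. As to minimality, [f]
    maps the number with digits [a, c] to [a (b + 1) + 2 c]. If two such values
    agree with distinct [a], their parts [2 c] differ by a nonzero multiple of
    [b + 1] smaller than [2 (b + 1)], hence by [b + 1], so [b] is odd. For odd
    [b] one-digit numbers suffice, on which [f v = 2 v] is injective. *)
Require Import Defs.
From mathcomp Require Import all_boot finmap zify.
From mathcomp Require Import classical_sets cardinality.

Lemma mem_fiber (b u v : nat) :
  (v \in fset_set [set w : nat | f b w = u]%classic) = (f b v == u).
Proof.
rewrite in_fset_set; last exact: finite_fiber.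
by apply/idP/eqP => [/set_mem|/mem_set].
Qed.

Lemma F_eq2 (b u x y : nat) :
  x != y -> (forall v, f b v = u <-> v = x \/ v = y) -> F b u = 2.
Proof.
move=> xy fib; rewrite /F.
suff -> : fset_set [set v : nat | f b v = u]%classic = [fset x; y]%fset.
  by rewrite cardfs2 xy.
apply/fsetP => v; rewrite mem_fiber !inE.
by apply/eqP/orP => [/fib[]->|[]/eqP->]; rewrite ?eqxx; auto; apply/fib; auto.
Qed.

(** Minimality needs only this consequence of [F b u = 2]: a collision of [f] at [u]. *)
Lemma F_eq2_collision (b u : nat) :
  F b u = 2 -> exists x y, [/\ x != y, f b x = u & f b y = u].
Proof.
rewrite /F; set A := fset_set _; have mA v : v \in enum_fset A -> f b v = u.
  by rewrite -/(v \in A) mem_fiber => /eqP.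
have := fset_uniq A.
case: (enum_fset A) mA => [|x [|y [|z t]]] //= mA; rewrite inE andbT => xy _.
by exists x, y; split=> //; apply: mA; rewrite !inE eqxx ?orbT.
Qed.

(** Frees [s] from its cut-off at [v]: padding with vanishing digits brings both sums to the common
    range [maxn v n]. *)
Lemma s_expand (b v n : nat) :
  1 < b -> v < b ^ n -> s b v = \sum_(i < n) digit b v i.
Proof.
move=> hb vn.
have digit0 i : v < b ^ i -> digit b v i = 0.
  by move=> vi; rewrite /digit divn_small ?mod0n.
have widen k : k <= maxn v n -> v < b ^ k ->
    \sum_(i < k) digit b v i = \sum_(i < maxn v n) digit b v i.
  move=> km vk; rewrite -!(big_mkord xpredT (digit b v)).
  rewrite (@big_cat_nat _ _ _ k 0 (maxn v n)) //=.
  rewrite [X in _ + X]big_nat_cond [X in _ + X]big1 ?addn0 //.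
  move=> i /andP[/andP[ki _] _]; apply: digit0.
  by apply: (leq_trans vk); rewrite leq_exp2l.
by rewrite /s !widen ?leq_maxl ?leq_maxr // ltn_expl.
Qed.

Lemma f_one_digit (b v : nat) : 1 < b -> v < b -> f b v = 2 * v.
Proof.
move=> hb vb; rewrite /f (@s_expand b v 1) ?expn1 // big_ord1 /digit.
by rewrite expn0 divn1 modn_small // addnn mul2n.
Qed.

(** The digit [a] may be 0, so this covers every number below [b ^ 2]. *)
Lemma f_two_digits (b a c : nat) :
  1 < b -> a < b -> c < b -> f b (a * b + c) = a * (b + 1) + 2 * c.
Proof.
move=> hb ab cb; rewrite /f (@s_expand b _ 2) //; last by nia.
rewrite big_ord_recl big_ord1 /digit /= expn0 divn1 expn1.
rewrite modnMDl divnMDl ?(ltnW hb) // (divn_small cb) addn0 !modn_small //.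
by lia.
Qed.

Lemma f_expn (b n : nat) : 1 < b -> f b (b ^ n) = b ^ n + 1.
Proof.
move=> hb; rewrite /f (@s_expand b _ n.+1) ?ltn_exp2l // big_ord_recr /=.
rewrite /digit divnn expn_gt0 (ltnW hb) /= modn_small // big1 // => i _.
(* For [i < n] the quotient [b ^ (n - i)] is a multiple of [b], so its digit is 0. *)
by rewrite -expnB ?(ltnW hb) // 1?ltnW // -(@subnSK i n) // expnS modnMr.
Qed.

(** A zero digit sum would make every digit, hence [v], vanish. The strict inequality bounds the
    fibres to be computed. *)
Lemma ltn_f (b v : nat) : 1 < b -> 0 < v -> v < f b v.
Proof.
move=> hb v0; rewrite /f -[X in X < _]addn0 ltn_add2l lt0n; apply/eqP => s0.
have := digit_expansion v hb; rewrite big1 => [|i _]; first by lia.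
by move: s0 => /eqP; rewrite sum_nat_eq0 => /forallP/(_ i)/eqP->.
Qed.

Lemma two_digitsP (b v : nat) :
  1 < b -> v < b ^ 2 -> exists a c, [/\ a < b, c < b & v = a * b + c].
Proof.
move=> hb vb; exists (v %/ b), (v %% b); split; last exact: divn_eq.
  by rewrite ltn_divLR ?(ltnW hb).
by rewrite ltn_pmod ?(ltnW hb).
Qed.

(** Identifies an arbitrary [K2] with the explicit values. *)
Lemma is_K_unique (b n u w : nat) : is_K b n u -> is_K b n w -> u = w.
Proof.
move=> [Fu min_u] [Fw min_w].
by apply/eqP; rewrite eqn_leq min_u // min_w.
Qed.

Lemma is_K2_even (b : nat) : 1 < b -> ~~ odd b -> is_K b 2 (b ^ 2 + 1).
Proof.
move=> hb b_even; split.
  apply: (@F_eq2 _ _ (b ^ 2) ((b - 1) * b + 1)); first by apply/eqP; nia.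
  move=> v; split=> [fv|[]->]; last 2 first.
  - exact: f_expn.
  - by rewrite f_two_digits //; nia.
  have v0 : 0 < v by case: v fv => //; rewrite /f /s big_ord0 addn1.
  have vf : v < b ^ 2 + 1 by rewrite -fv; exact: ltn_f.
  case: (ltngtP v (b ^ 2)) => [v2||->]; [|lia|by left].
  have [a [c [ab cb vE]]] := @two_digitsP b v hb v2.
  right; move: fv; rewrite vE f_two_digits // => fv.
  (* Since [2 * c <= 2 * (b - 1)], a leading digit of at most [b - 3] cannot reach [b ^ 2 + 1]. The
     choice [a = b - 2] would give [2 * c = b + 3], which is odd; [a = b - 1] gives [c = 1]. *)
  have a_big : b - 2 <= a by nia.
  have [aE|aE] : a = b - 2 \/ a = b - 1 by lia.
    by nia.
  by nia.
move=> w /F_eq2_collision[x [y [xy fx fy]]]; rewrite leqNgt; apply/negP => wb.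
(* From [v <= f b v = w <= b ^ 2], only [v = b ^ 2] remains to be excluded, and its image exceeds
   [w]. *)
have small v : f b v = w -> v < b ^ 2.
  move=> fv; rewrite ltn_neqAle; apply/andP; split.
    by apply/eqP => vE; move: fv; rewrite vE f_expn //; lia.
  by move: fv; rewrite /f; lia.
have [a [c [ab cb xE]]] := @two_digitsP b x hb (small x fx).
have [a' [c' [ab' cb' yE]]] := @two_digitsP b y hb (small y fy).
move: fx fy xy; rewrite xE yE !f_two_digits // => <- E /eqP xy.
case: (ltngtP a a') => [lt|lt|eqa]; last by subst a'; apply: xy; lia.
  by have a'E : a' = a + 1 by [nia]; subst a'; lia.
by have aE : a = a' + 1 by [nia]; subst a; lia.
Qed.

Lemma is_K2_odd (b : nat) : 1 < b -> odd b -> is_K b 2 (b + 1).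
Proof.
move=> hb b_odd; have fb : f b b = b + 1 by have := @f_expn b 1 hb; rewrite expn1.
split.
  (* Below [b] the map [f] doubles, so the second preimage is half of the even number [b + 1]; it is
     less than [b] because [b] is at least 3. *)
  apply: (@F_eq2 _ _ b (b.+1)./2); first by apply/eqP; lia.
  move=> v; split=> [fv|[]->] //; last by rewrite f_one_digit //; lia.
  have v0 : 0 < v by case: v fv => //; rewrite /f /s big_ord0 addn1.
  have vf : v < b + 1 by rewrite -fv; exact: ltn_f.
  case: (ltngtP v b) => [vb||->]; [|lia|by left].
  by right; move: fv; rewrite f_one_digit //; lia.
move=> w /F_eq2_collision[x [y [xy fx fy]]]; rewrite leqNgt; apply/negP => wb.
have small v : f b v = w -> v < b.
  move=> fv; rewrite ltn_neqAle; apply/andP; split.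
    by apply/eqP => vE; move: fv; rewrite vE fb; lia.
  by move: fv; rewrite /f; lia.
have [xb yb] := (small x fx, small y fy).
by move: fx fy xy; rewrite !f_one_digit // => <-; lia.
Qed.

Theorem theorem4p2 (b : nat) (hb : 2 <= b) :
  [/\ ~~ odd b -> is_K b 2 (b ^ 2 + 1),
      odd b -> is_K b 2 (b + 1)
    & forall K2 : nat, is_K b 2 K2 ->
      let B2 := trunc_log b K2 in
      [/\ exists2 r : nat, r < b ^ B2 & K2 = b ^ B2 + r,
          ~~ odd b -> B2 = 2
        & odd b -> B2 = 1]].
Proof.
split; [exact: is_K2_even|exact: is_K2_odd|move=> K2 K2P B2].
have [b_odd|b_even] := boolP (odd b).
  have K2E : K2 = b ^ 1 + 1.
    by rewrite expn1; apply: is_K_unique K2P (@is_K2_odd b hb b_odd).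
  have B2E : B2 = 1 by apply: trunc_log_eq => //; rewrite K2E; nia.
  by split=> //; rewrite B2E; exists 1; rewrite // expn1.
have K2E : K2 = b ^ 2 + 1 by apply: is_K_unique K2P (@is_K2_even b hb b_even).
have B2E : B2 = 2.
  by apply: trunc_log_eq => //; rewrite K2E leq_addr expnS; nia.
(* The remainder 1 is viewed as [b ^ 0] to compare it with [b ^ 2]. *)
by split=> //; rewrite B2E; exists 1; rewrite // -[1](expn0 b) ltn_exp2l.
Qed.
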